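(* Let $\mathcal{H}$ and $\mathcal{G}$ be real Hilbert spaces, let $L\colon\mathcal{H}\to\mathcal{G}$ be a bounded linear operator, let $B\colon\mathcal{G}\to 2^{\mathcal{G}}$ be a set-valued operator, let $\gamma\in(0,+\infty)$, and set $\Psi=\mathrm{Id}_{\mathcal{G}}-L\circ L^*$. Then the following hold: (i) $L\overset{\gamma}{\diamond}B=L^*\triangleright(B+\gamma^{-1}\Psi)$. (ii) $L\overset{\gamma}{\bullet}B=L^*\circ(B^{-1}+\gamma\Psi)^{-1}\circ L$.
   Context: For a set-valued operator $A$, $A^{-1}$ is defined by $x\in A^{-1}x^*\Leftrightarrow x^*\in Ax$. Single-valued maps are identified with set-valued ones; sums, scalar multiples and compositions are pointwise, e.g. $(L^*\circ C\circ L)x=\{L^*y\mid y\in C(Lx)\}$. For a bounded linear $L\colon\mathcal{H}\to\mathcal{G}$ with adjoint $L^*$ and $C\colon\mathcal{G}\to2^{\mathcal{G}}$, the parallel composition is $L^*\triangleright C=(L^*\circ C^{-1}\circ L)^{-1}\colon\mathcal{H}\to2^{\mathcal{H}}$. For $\gamma>0$, the resolvent composition is $L\overset{\gamma}{\diamond}C=L^*\triangleright(C+\gamma^{-1}\mathrm{Id}_{\mathcal{G}})-\gamma^{-1}\mathrm{Id}_{\mathcal{H}}\colon\mathcal{H}\to2^{\mathcal{H}}$, and the resolvent cocomposition is $L\overset{\gamma}{\bullet}C=(L\overset{1/\gamma}{\diamond}C^{-1})^{-1}\colon\mathcal{H}\to2^{\mathcal{H}}$. *)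

(* Defs.v *)
From HB Require Import structures.
From mathcomp Require Import all_boot all_order all_algebra.
From mathcomp Require Import all_classical all_reals.
From mathcomp Require Import topology normedtype sequences.
From mathcomp Require Import ring lra.

Set Implicit Arguments.
Unset Strict Implicit.
Unset Printing Implicit Defensive.

Import Order.TTheory GRing.Theory Num.Theory.
Import numFieldNormedType.Exports.

Local Open Scope classical_set_scope.
Local Open Scope ring_scope.

HB.mixin Record CompleteNormedModule_isHilbert (R : realType) (V : Type)
    of CompleteNormedModule R V := {
  inner : {dot V for (@idfun R)} ;
  inner_norm : forall x : V, inner x x = `|x| ^+ 2
}.

#[short(type="hilbertType")]
HB.structure Definition Hilbert (R : realType) :=
  {V of CompleteNormedModule R V & CompleteNormedModule_isHilbert R V}.

Declare Scope hilbert_scope.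
Notation "<< x , y >>" := ((inner : {dot _ for idfun}) x y)
  (format "<< x ,  y >>") : hilbert_scope.
Local Open Scope hilbert_scope.

Section Inner.
Context {R : realType} {H : hilbertType R}.
Implicit Types (x y z : H) (a : R).

Lemma innerC x y : << x, y >> = << y, x >>.
Proof. by rewrite hermC mul1r. Qed.

Lemma innerDr x y z : << x, y + z >> = << x, y >> + << x, z >>.
Proof. exact: linearDr. Qed.

Lemma innerZr a x y : << x, a *: y >> = a * << x, y >>.
Proof. exact: linearZr_LR. Qed.

Lemma innerNr x y : << x, - y >> = - << x, y >>.
Proof. by rewrite -scaleN1r innerZr mulN1r. Qed.

Lemma normD_inner x y :
  `|x + y| ^+ 2 = `|x| ^+ 2 + 2 * << x, y >> + `|y| ^+ 2.
Proof.
rewrite -!inner_norm innerDr (innerC _ x) (innerC _ y) !innerDr (innerC y x).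
by ring.
Qed.

Lemma normB_inner x y :
  `|x - y| ^+ 2 = `|x| ^+ 2 - 2 * << x, y >> + `|y| ^+ 2.
Proof. by rewrite normD_inner innerNr normrN mulrN. Qed.

Lemma eq_inner x y : (forall z, << z, x >> = << z, y >>) -> x = y.
Proof.
move=> xy; apply/eqP; rewrite -subr_eq0 -normr_eq0 -sqrf_eq0 -inner_norm.
by rewrite innerDr innerNr xy subrr.
Qed.

Lemma continuous_inner (T : topologicalType) (f : T -> H) x :
  continuous f -> continuous (fun t => << f t, x >> : R^o).
Proof.
move=> fc.
have -> : (fun t => << f t, x >> : R^o) =
    fun t => 2^-1 * (`|f t + x| ^+ 2 - `|f t| ^+ 2 - `|x| ^+ 2).
  by apply/funext => t; rewrite normD_inner; field.
have sq (g : T -> H) : continuous g -> continuous (fun t => `|g t| ^+ 2 : R^o).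
  move=> gc t.
  have gt : (fun t => `|g t| : R^o) @ t --> `|g t| by apply: cvg_norm; exact: gc.
  have -> : (fun t => `|g t| ^+ 2 : R^o) = (fun t => (`|g t| : R^o) * `|g t|).
    by apply/funext => u; rewrite expr2.
  by apply: cvgM.
move=> t; apply: cvgM; first exact: cvg_cst.
apply: cvgB; last exact: cvg_cst.
apply: cvgB; last exact: (sq f fc t).
apply: (sq (fun t => f t + x)) => u.
by apply: cvgD; [exact: fc|exact: cvg_cst].
Qed.

Lemma riesz (f : {linear H -> R^o}) : continuous f ->
  exists x, forall z, << z, x >> = f z.
Proof.
move=> fc.
have fD x y : f (x + y) = f x + f y by rewrite linearD.
have fZ a x : f (a *: x) = a * f x by rewrite linearZ.
pose J x : R := `|x| ^+ 2 - 2 * f x.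
have Jlb : has_lbound (range J).
  have /linear_boundedP/pinfty_ex_gt0[r r0 fr] :=
    (@linear_bounded_continuous _ _ _ f).2 fc.
  exists (- r ^+ 2) => _ [x _ <-]; rewrite /J.
  have := fr x; rewrite ler_norml => /andP[_ fx].
  have := sqr_ge0 (`|x| - r); nra.
have Jinf : has_inf (range J) by split=> //; exists (J 0), 0.
pose m := inf (range J).
have mJ x : m <= J x by apply: ge_inf; [case: Jinf|exists x].
have /choice[u uJ] : forall n : nat, exists x, J x < m + n.+1%:R^-1.
  move=> n; have n0 : 0 < (n.+1%:R^-1 : R) by rewrite invr_gt0.
  by have [_ [x _ <-] xm] := inf_adherent n0 Jinf; exists x.
have para x y : `|x - y| ^+ 2 <= 2 * (J x - m) + 2 * (J y - m).
  have := mJ (2^-1 *: (x + y)).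
  rewrite /J normrZ exprMn fZ fD normB_inner normD_inner ger0_norm//; lra.
have Jc : continuous (J : H -> R^o).
  move=> x; apply: cvgB.
    have -> : (fun x : H => `|x| ^+ 2 : R^o) = (fun x => (`|x| : R^o) * `|x|).
      by apply/funext => ?; rewrite expr2.
    by apply: cvgM; apply: cvg_norm; exact: cvg_id.
  by apply: cvgM; [exact: cvg_cst|exact: fc].
have cu : cvgn u.
  apply: cauchy_cvg; apply/cauchyP => e e0.
  pose N := Num.truncn (4 / e ^+ 2).
  exists (u N), N => // k /= Nk; rewrite -ball_normE/=.
  rewrite -(@ltr_pXn2r _ 2)// ?nnegrE//; last exact: ltW.
  have e2 : 0 < e ^+ 2 by rewrite exprn_gt0.
  have Ne : (N.+1%:R^-1 : R) < e ^+ 2 / 4.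
    rewrite invf_plt ?posrE// ?divr_gt0// invf_div.
    exact: truncnS_gt.
  have kN : (k.+1%:R^-1 : R) <= N.+1%:R^-1 by rewrite lef_pV2 ?posrE// ler_nat.
  have := para (u N) (u k); have := uJ N; have := uJ k.
  move: Ne kN; move: (k.+1%:R^-1 : R) (N.+1%:R^-1 : R) (J _) (J _) => a b c d; lra.
pose x := limn u.
have Jx : J x <= m.
  have Jux : J \o u @ \oo --> J x by apply: continuous_cvg; [exact: Jc|exact: cu].
  have mu : (cst m : nat -> R^o) + @harmonic R @ \oo --> m + 0.
    by apply: cvgD; [exact: cvg_cst|exact: cvg_harmonic].
  rewrite addr0 in mu.
  by apply: (ler_cvg_to Jux mu); apply: nearW => n; exact: (ltW (uJ n)).
exists x => z; apply/eqP; rewrite -subr_eq0; apply/eqP.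
set d := << z, x >> - f z.
have quad t : 0 <= 2 * t * d + t ^+ 2 * `|z| ^+ 2.
  have := le_trans Jx (mJ (x + t *: z)).
  rewrite /J normD_inner innerZr normrZ exprMn real_normK ?num_real//.
  rewrite fD fZ /d (innerC z x); lra.
have := quad (- d / (`|z| ^+ 2 + 1)).
set q := `|z| ^+ 2.
have q0 : 0 <= q by exact: sqr_ge0.
have q1 : 0 < q + 1 by lra.
have -> : 2 * (- d / (q + 1)) * d + (- d / (q + 1)) ^+ 2 * q =
    - (d ^+ 2 * (q + 2) / (q + 1) ^+ 2) by field; lra.
rewrite oppr_ge0 pmulr_lle0 ?invr_gt0 ?exprn_gt0// pmulr_lle0; last by lra.
move=> d2; apply/eqP; rewrite -sqrf_eq0; apply/eqP.
by apply/le_anti; rewrite d2 sqr_ge0.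
Qed.

End Inner.

Section Adjoint.
Context {R : realType} {H G : hilbertType R}.

(* The adjoint is chosen by its defining property; [adjointP] gives its
   existence and [adjoint_unique] its uniqueness for bounded linear [L]. *)
Definition adjoint (L : H -> G) (y : G) : H :=
  xget 0 [set x | forall z, << z, x >> = << L z, y >>].

Lemma adjointP (L : {linear H -> G}) : bounded_near L (nbhs 0) ->
  forall z y, << z, adjoint L y >> = << L z, y >>.
Proof.
move=> /linear_bounded_continuous Lc z y.
pose f z : R^o := << L z, y >>.
have fl : linear f.
  move=> a u v; rewrite /f linearP innerC innerDr innerZr.
  by rewrite (innerC y) (innerC y (L v)).
pose F : {linear H -> R^o} :=
  HB.pack f (GRing.isLinear.Build _ _ _ _ f fl).
have [|x xP] := @riesz _ _ F; first exact: continuous_inner.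
have := xgetPex 0 (ex_intro [set x | forall z, << z, x >> = << L z, y >>] x xP).
by move=> /(_ z).
Qed.

Lemma adjoint_unique (L : {linear H -> G}) (M : G -> H) :
  bounded_near L (nbhs 0) ->
  (forall z y, << z, M y >> = << L z, y >>) -> M = adjoint L.
Proof.
move=> Lb MP; apply/funext => y; apply: eq_inner => z.
by rewrite MP adjointP.
Qed.

End Adjoint.

(* A set-valued operator from [X] to [Y] is a map [X -> set Y]; equality of
   operators is equality of their values, that is, of their graphs. *)
Section SetValued.
Context {X Y Z : Type}.

Definition sv_fun (f : X -> Y) : X -> set Y := fun x => [set f x].

Definition sv_inv (A : X -> set Y) : Y -> set X := fun y => [set x | A x y].

Definition sv_comp (A : Y -> set Z) (B : X -> set Y) : X -> set Z :=
  fun x => \bigcup_(y in B x) A y.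

End SetValued.

Section SetValuedAlgebra.
Context {X : Type} {R : realType} {V : lmodType R}.
Implicit Types A B : X -> set V.

Definition sv_add A B : X -> set V :=
  fun x => [set u + v | u in A x & v in B x].

Definition sv_sub A B : X -> set V :=
  fun x => [set u - v | u in A x & v in B x].

Definition sv_scale (a : R) A : X -> set V := fun x => [set a *: u | u in A x].

End SetValuedAlgebra.

Section Compositions.
Context {R : realType} {H G : hilbertType R}.
Implicit Types (L : H -> G) (gamma : R) (C : G -> set G).

(* [parallel_comp L C] is the parallel composition of the adjoint of [L]
   with [C]. *)
Definition parallel_comp L C : H -> set H :=
  sv_inv (sv_comp (sv_fun (adjoint L)) (sv_comp (sv_inv C) (sv_fun L))).

Definition resolvent_comp L gamma C : H -> set H :=
  sv_sub (parallel_comp L (sv_add C (sv_scale gamma^-1 (sv_fun idfun))))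
         (sv_scale gamma^-1 (sv_fun idfun)).

Definition resolvent_cocomp L gamma C : H -> set H :=
  sv_inv (resolvent_comp L gamma^-1 (sv_inv C)).

End Compositions.

(* Main.v *)
Require Import Defs.
From mathcomp Require Import all_boot all_order all_algebra.
From mathcomp Require Import all_classical all_reals.
From mathcomp Require Import topology normedtype.

Import Order.TTheory GRing.Theory Num.Theory.
Import numFieldNormedType.Exports.

Local Open Scope classical_set_scope.
Local Open Scope ring_scope.

(* Substituting [u = v + gamma^-1 x] in [v \in (L <> C) x] turns
   [L u \in C y + gamma^-1 y] with [x = L^* y] into
   [L v \in C y + gamma^-1 (y - L (L^* y))]; the cocomposition is the inverse
   of a composition, so its formula is the same one read for [B^-1] and
   [gamma^-1]. *)

Lemma parallel_compP (R : realType) (H G : hilbertType R) (L : H -> G)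
    (C : G -> set G) (x u : H) :
  parallel_comp L C x u <-> exists2 y, C y (L u) & x = adjoint L y.
Proof.
split=> [[y [_ -> Cy] xE]|[y Cy xE]]; first by exists y.
by exists y => //; exists (L u).
Qed.

(** A single-valued summand only translates the set of values, so it can be moved across the
    membership, and the existentials hidden in [sv_add] and [sv_scale] disappear. *)
Lemma sv_add_scale_funP (X : Type) (R : realType) (V : lmodType R)
    (A : X -> set V) (a : R) (f : X -> V) (x : X) (w : V) :
  sv_add A (sv_scale a (sv_fun f)) x w <-> A x (w - a *: f x).
Proof.
split=> [[u Au [_ [_ -> <-] <-]]|Aw]; first by rewrite addrK.
by exists (w - a *: f x) => //; exists (a *: f x); [exists (f x)|rewrite subrK].
Qed.

Lemma sv_sub_scale_funP (X : Type) (R : realType) (V : lmodType R)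
    (A : X -> set V) (a : R) (f : X -> V) (x : X) (w : V) :
  sv_sub A (sv_scale a (sv_fun f)) x w <-> A x (w + a *: f x).
Proof.
split=> [[u Au [_ [_ -> <-] <-]]|Aw]; first by rewrite subrK.
by exists (w + a *: f x) => //; exists (a *: f x); [exists (f x)|rewrite addrK].
Qed.

Lemma resolvent_compE (R : realType) (H G : hilbertType R)
    (L : {linear H -> G}) (gamma : R) (C : G -> set G) :
  resolvent_comp L gamma C =
  parallel_comp L (sv_add C
    (sv_scale gamma^-1 (sv_fun (fun y => y - L (adjoint L y))))).
Proof.
apply/funext => x; apply/seteqP.
(* The two sides are the points of [C y] required by the two operators once [x = adjoint L y]. Since
   they agree, the same [y] is a witness in both inclusions below. *)
have shift y v : L (v + gamma^-1 *: adjoint L y) - gamma^-1 *: y =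
    L v - gamma^-1 *: (y - L (adjoint L y)).
  by rewrite linearD linearZ scalerBr opprB addrA.
split=> v.
  move=> /sv_sub_scale_funP/parallel_compP[y /sv_add_scale_funP Cy xE].
  apply/parallel_compP; exists y => //; apply/sv_add_scale_funP.
  by rewrite -shift -xE.
move=> /parallel_compP[y /sv_add_scale_funP Cy xE].
apply/sv_sub_scale_funP/parallel_compP; exists y => //.
by apply/sv_add_scale_funP; rewrite xE shift.
Qed.

Theorem proposition3p3 (R : realType) (H G : hilbertType R)
    (L : {linear H -> G}) (hL : bounded_near L (nbhs (0 : H)))
    (B : G -> set G) (gamma : R) (hgamma : 0 < gamma) :
  let Psi : G -> G := fun y => y - L (adjoint L y) in
  resolvent_comp L gamma B =
    parallel_comp L (sv_add B (sv_scale gamma^-1 (sv_fun Psi))) /\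
  resolvent_cocomp L gamma B =
    sv_comp (sv_fun (adjoint L))
      (sv_comp (sv_inv (sv_add (sv_inv B) (sv_scale gamma (sv_fun Psi))))
        (sv_fun L)).
Proof.
move=> Psi; split; first exact: resolvent_compE.
(* [parallel_comp] is itself an [sv_inv], so the outer inverse cancels it by conversion. [invrK]
   turns the inverse of [gamma^-1] back into [gamma]. *)
by rewrite /resolvent_cocomp resolvent_compE invrK.
Qed.
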